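(* Let $\lambda\in(0,1]$ and $0<\theta\le\frac{1}{\lambda+1}$. Set $d=4\theta\sqrt{\lambda(1-\theta)(1-\lambda\theta)}$, $s=2\theta(1+\lambda-2\lambda\theta)$ and $$\nu_{\lambda,\theta}(dx)=\frac{d^2}{2\pi\lambda\theta}\,\frac{\sqrt{1-x^2}}{s(2-s)+2d(1-s)x-d^2x^2}\,\mathbf{1}_{[-1,1]}(x)\,dx .$$ Set $$c=\frac{1}{2(1-\lambda\theta)},\qquad b=\sqrt{\frac{\lambda}{(1-\theta)(1-\lambda\theta)}}\,(2\theta-1).$$ The orthogonal polynomials corresponding to $\nu_{\lambda,\theta}$ are $$Q_n^{\lambda,\theta}=U_n-2b\,U_{n-1}+(1-2c)\,U_{n-2},\qquad n\ge0,\quad U_{-1}=U_{-2}=0,$$ where $U_n$ is the $n$-th Tchebycheff polynomial of the second kind, $U_n(\cos\alpha)=\sin((n+1)\alpha)/\sin\alpha$. The Jacobi-Szegő parameters of $\nu_{\lambda,\theta}$ are $\alpha_0=b$, $\alpha_n=0$ for $n\ge1$, $\omega_1=\frac c2$, $\omega_n=\frac14$ for $n\ge2$. Moreover, on the one-mode interacting Fock space associated with $\nu_{\lambda,\theta}$, i.e. with $(\omega_n)_{n\ge1}$, the measure $\nu_{\lambda,\theta}$ is the vacuum distribution (in the vacuum state $\Phi_0$) of any extension of the operator $a^++a+\alpha_N$, where $a^+$, $a$ and $N$ are the creation, annihilation and number operators.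
   Context: The measure $\nu_{\lambda,\theta}$ is the image of the spectral measure $\mu_{\lambda,\theta}(dx)=\frac{1}{2\pi\lambda\theta}\frac{\sqrt{(x_+-x)(x-x_-)}}{x(1-x)}\mathbf{1}_{[x_-,x_+]}(x)dx$, $x_\pm=\bigl(\sqrt{\theta(1-\lambda\theta)}\pm\sqrt{\lambda\theta(1-\theta)}\bigr)^2$, of the stationary free Jacobi process under the map $x\mapsto\frac{2x-s}{d}$, where $d=x_+-x_-$ and $s=x_++x_-$. The Jacobi-Szegő parameters $(\alpha_n,\omega_n)$ of a measure are the coefficients in the recurrence $(x-\alpha_n)P_n(x)=P_{n+1}(x)+\omega_nP_{n-1}(x)$, $P_{-1}:=0$, satisfied by its monic orthogonal polynomials $P_n$. Given $\omega_n>0$, $n\ge1$, put $\lambda_0=1$ and $\lambda_n=\omega_1\cdots\omega_n$. The one-mode interacting Fock space is the infinite orthogonal sum of the one-dimensional spaces $\mathbb{C}\Phi_n$, $n\ge0$, where $\mathbb{C}\Phi_n$ carries the scalar product $(z_1\Phi_n,z_2\Phi_n)=\lambda_n\overline{z_1}z_2$. On the linear span of the $\Phi_n$: $a^+\Phi_n=\Phi_{n+1}$; $a\Phi_{n+1}=\omega_{n+1}\Phi_n=\frac{\lambda_{n+1}}{\lambda_n}\Phi_n$ and $a\Phi_0=0$; $N\Phi_n=n\Phi_n$; $\alpha_N$ is defined by the spectral theorem, that is $\alpha_N\Phi_n=\alpha_n\Phi_n$. That $\nu$ is the vacuum distribution of an operator $X$ means $(\Phi_0,X^k\Phi_0)=\int_{\mathbb{R}}x^k\,\nu(dx)$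 for every integer $k\ge0$.
   Formalization: The constant b is taken as half the printed value, b = (1/2)·sqrt(λ/((1-θ)(1-λθ)))·(2θ-1); as printed the claim fails for θ ≠ 1/2 (e.g. λ=1, θ=1/4: the mean α_0 is -1/3, the printed b is -2/3). *)

(* Defs.v *)
From HB Require Import structures.
From mathcomp Require Import all_boot all_order all_algebra.
From mathcomp Require Import all_classical all_reals all_analysis.
From mathcomp Require Import measurable_realfun.
From mathcomp Require Export complex.
From mathcomp Require Import ring lra.

Set Implicit Arguments.
Unset Strict Implicit.
Unset Printing Implicit Defensive.

Import Order.TTheory GRing.Theory Num.Theory.
Import numFieldNormedType.Exports.

Local Open Scope classical_set_scope.
Local Open Scope ring_scope.

(** * Tchebycheff polynomials of the second kind *)

Section chebyshev.
Context (R : realType).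

Fixpoint chebU_rec (n : nat) : {poly R} * {poly R} :=
  if n is m.+1 then
    let: (p, q) := chebU_rec m in (q, 2%:P * 'X * q - p)
  else (1, 2%:P * 'X).

(* Integer-indexed, with the convention U_m = 0 for every m < 0; the recurrence
   extended to negative indices would instead give U_{-2} = -1. *)
Definition chebU (m : int) : {poly R} :=
  if m is Posz n then (chebU_rec n).1 else 0.

Lemma chebU0 : chebU 0 = 1. Proof. by []. Qed.

Lemma chebU1 : chebU 1 = 2%:P * 'X. Proof. by []. Qed.

Lemma chebUSS (n : nat) :
  chebU n.+2 = 2%:P * 'X * chebU n.+1 - chebU n.
Proof. by rewrite /chebU /=; case: (chebU_rec n) => p q. Qed.

Lemma chebU_cos (n : nat) (a : R) : sin a != 0 ->
  (chebU n).[cos a] = sin (n.+1%:R * a) / sin a.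
Proof.
move=> sa0; suff H : forall k : nat, (chebU k).[cos a] * sin a = sin (k.+1%:R * a).
  by rewrite -H mulfK.
move=> k; elim/ltn_ind: k => -[|[|k]] IH.
- by rewrite chebU0 hornerE mul1r mul1r.
- rewrite chebU1 !hornerE (_ : 2%:R * a = a + a); last by ring.
  by rewrite sinD [sin a * _]mulrC -mulrA mulr_natl mulr2n.
rewrite chebUSS !hornerE mulrBl -[_ * _.[_] * _]mulrA !IH//.
have -> : k.+1%:R * a = k.+2%:R * a - a by rewrite -[k.+2]addn1 natrD; ring.
have -> : k.+3%:R * a = k.+2%:R * a + a by rewrite -[k.+3]addn1 natrD; ring.
by rewrite sinB sinD; ring.
Qed.

End chebyshev.

(** * Orthogonal polynomials and Jacobi-Szego parameters of a measure *)

Section orthogonal_polynomials.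
Context (R : realType) (nu : {measure set (measurableTypeR R) -> \bar R}).

Definition finite_moments : Prop :=
  forall k : nat, nu.-integrable setT (fun x => (x ^+ k)%:E).

Definition orthogonal_polynomials (P : nat -> {poly R}) : Prop :=
  [/\ finite_moments,
      forall n, size (P n) = n.+1,
      forall n, 0 < \int[nu]_x ((P n).[x] ^+ 2) &
      forall m n, m != n -> \int[nu]_x ((P m).[x] * (P n).[x]) = 0].

(* The value of [omega] at 0 plays no role, since P_{-1} = 0. *)
Definition jacobi_szego (alpha omega : nat -> R) : Prop :=
  exists P : nat -> {poly R},
    [/\ orthogonal_polynomials P,
        forall n, P n \is monic &
        forall n, ('X - (alpha n)%:P) * P n =
          P n.+1 + omega n *: (if n is m.+1 then P m else 0)].

End orthogonal_polynomials.

(** * One-mode interacting Fock space *)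

Section fock.
Context (R : realType) (omega : nat -> R).
Local Notation C := R[i].
Local Notation vec := (nat -> C).

Definition fock_weight (n : nat) : R := \prod_(1 <= k < n.+1) omega k.

(* The vector \sum_n (f n) Phi_n is represented by its coordinate sequence f. *)
Definition fock_space : set vec :=
  [set f | cvgn (series (fun n =>
     fock_weight n * ComplexField.Normc.normc (f n) ^+ 2))].

Definition fock_inner (f g : vec) : C :=
  limn (series (fun n => (fock_weight n)%:C%C * (f n)^*%C * g n : C^o)).

Definition Phi (k : nat) : vec := fun n => (n == k)%:R.

Definition Phi_span : set vec :=
  [set f | exists (m : nat) (z : nat -> C),
     f = fun n => \sum_(k < m) z k * Phi k n].

Definition creation (f : vec) : vec := fun n => if n is m.+1 then f m else 0.

Definition annihilation (f : vec) : vec :=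
  fun n => (omega n.+1)%:C%C * f n.+1.

(* The operator phi(N), diagonal in the basis of eigenvectors of N. *)
Definition number_calculus (phi : nat -> R) (f : vec) : vec :=
  fun n => (phi n)%:C%C * f n.

Definition number : vec -> vec := number_calculus (fun n => n%:R).

Lemma creation_Phi k : creation (Phi k) = Phi k.+1.
Proof. by apply/funext => -[|n]. Qed.

Lemma annihilation_Phi0 : annihilation (Phi 0%N) = fun=> 0.
Proof. by apply/funext => n; rewrite /annihilation /Phi mulr0. Qed.

Lemma annihilation_PhiS k :
  annihilation (Phi k.+1) = fun n => (omega k.+1)%:C%C * Phi k n.
Proof.
apply/funext => n; rewrite /annihilation /Phi eqSS.
by case: eqP => [->|_] //; rewrite !mulr0.
Qed.

Lemma number_Phi k : number (Phi k) = fun n => k%:R * Phi k n.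
Proof.
apply/funext => n; rewrite /number /number_calculus /Phi.
by case: eqP => [->|_]; rewrite ?mulr0 // rmorph_nat.
Qed.

Lemma number_calculus_eigen (phi : nat -> R) k (f : vec) :
  number f = (fun n => k%:R * f n) ->
  number_calculus phi f = fun n => (phi k)%:C%C * f n.
Proof.
move=> /funeqP Nf; apply/funext => n; move: (Nf n).
rewrite /number /number_calculus rmorph_nat.
have [->|fn0] := eqVneq (f n) 0; first by rewrite !mulr0.
by move=> /(mulIf fn0)/eqP; rewrite eqr_nat => /eqP ->.
Qed.

Definition fock_hamiltonian (alpha : nat -> R) (f : vec) : vec :=
  fun n => creation f n + annihilation f n + number_calculus alpha f n.

(* A (possibly unbounded) linear operator with domain D; the values of X
   outside D are irrelevant. *)
Definition fock_operator (D : set vec) (X : vec -> vec) : Prop :=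
  [/\ D `<=` fock_space,
      forall f, D f -> fock_space (X f) &
      forall (z : C) (f g : vec), D f -> D g ->
        D (fun n => z * f n + g n) /\
        X (fun n => z * f n + g n) = (fun n => z * X f n + X g n)].

Definition extends (D : set vec) (X : vec -> vec)
    (D0 : set vec) (X0 : vec -> vec) : Prop :=
  D0 `<=` D /\ {in D0, X =1 X0}.

Definition vacuum_distribution (X : vec -> vec)
    (nu : {measure set (measurableTypeR R) -> \bar R}) : Prop :=
  finite_moments nu /\
  forall k : nat,
    fock_inner (Phi 0%N) (iter k X (Phi 0%N)) = (\int[nu]_x (x ^+ k))%:C%C.

End fock.

(** * The measure nu_{lambda, theta} *)

Lemma measurable_inv (R : realType) : measurable_fun setT (@GRing.inv R).
Proof.
have o0 : open [set x : R | x != 0].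
  by rewrite (_ : [set _ | _] = ~` [set 0]) ?openC;
    [exact: closed_eq | apply/seteqP; split => x /=; move/eqP].
rewrite -(setUv [set x : R | x != 0]).
apply/measurable_funU; [exact: open_measurable
  | by apply: measurableC; exact: open_measurable | split].
  apply: open_continuous_measurable_fun => // x; rewrite inE /=.
  exact: inv_continuous.
rewrite (_ : ~` _ = [set 0]); first exact: measurable_fun_set1.
by apply/seteqP; split => x /= => [/negP|->]; [rewrite negbK => /eqP|rewrite eqxx].
Qed.

Section free_jacobi.
Context (R : realType) (lambda theta : R).

Definition jacobi_d : R :=
  4 * theta * Num.sqrt (lambda * (1 - theta) * (1 - lambda * theta)).

Definition jacobi_s : R := 2 * theta * (1 + lambda - 2 * lambda * theta).

Definition jacobi_c : R := (2 * (1 - lambda * theta))^-1.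

(* CORRECTION: the source prints b without the factor 1/2.  As printed the
   theorem fails whenever theta != 1/2: alpha_0 has to be the mean of the
   measure below, and that mean is the present b, half of the printed one.
   Example: for lambda = 1, theta = 1/4 the density is
   (6/pi) sqrt((1-x)/(1+x)) / (5-3x) on [-1,1], of mean -1/3, whereas the
   printed b is -2/3. *)
Definition jacobi_b : R :=
  2^-1 * Num.sqrt (lambda / ((1 - theta) * (1 - lambda * theta))) *
  (2 * theta - 1).

Definition jacobi_density (x : R) : R :=
  jacobi_d ^+ 2 / (2 * pi * lambda * theta) *
  (Num.sqrt (1 - x ^+ 2) /
   (jacobi_s * (2 - jacobi_s) + 2 * jacobi_d * (1 - jacobi_s) * x
    - jacobi_d ^+ 2 * x ^+ 2)) *
  \1_(`[-1, 1] : set R) x.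

Definition jacobi_alpha (n : nat) : R := if n is 0 then jacobi_b else 0.

Definition jacobi_omega (n : nat) : R := if n == 1%N then jacobi_c / 2 else 4^-1.

Definition jacobi_Q (n : nat) : {poly R} :=
  chebU R n - (2 * jacobi_b) *: chebU R (n%:Z - 1)
  + (1 - 2 * jacobi_c) *: chebU R (n%:Z - 2).

Lemma jacobi_d2 : 0 < lambda <= 1 -> 0 < theta <= (lambda + 1)^-1 ->
  jacobi_d ^+ 2 =
  16 * theta ^+ 2 * (lambda * (1 - theta) * (1 - lambda * theta)).
Proof.
move=> /andP[l0 l1] /andP[t0]; rewrite -div1r ler_pdivlMr; last by lra.
by move=> tl; rewrite /jacobi_d exprMn sqr_sqrtr; [ring | nra].
Qed.

Lemma jacobi_density_ge0 (x : R) :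
  0 < lambda <= 1 -> 0 < theta <= (lambda + 1)^-1 -> 0 <= jacobi_density x.
Proof.
move=> hl ht; have d2 := jacobi_d2 hl ht.
case/andP: (hl) => l0 l1; case/andP: (ht) => t0.
rewrite -div1r ler_pdivlMr; last by lra.
move=> tl; rewrite /jacobi_density indicE.
have [|] := boolP (x \in _); last by rewrite mulr0.
rewrite inE /= in_itv /= => /andP[xN1 x1]; rewrite mulr1 mulr_ge0//.
  by rewrite divr_ge0 ?sqr_ge0 // !mulr_ge0 ?pi_ge0 // ltW.
rewrite divr_ge0 ?sqrtr_ge0//.
set s := jacobi_s; set d := jacobi_d.
have -> : s * (2 - s) + 2 * d * (1 - s) * x - d ^+ 2 * x ^+ 2 =
  (s + d * x) * (2 - s - d * x) by ring.
have d0 : 0 <= d by rewrite /d /jacobi_d !mulr_ge0 ?sqrtr_ge0 // ltW.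
have s0 : 0 <= s by rewrite /s /jacobi_s; nra.
have s2 : 0 <= 2 - s.
  rewrite subr_ge0 /s /jacobi_s.
  by have := sqr_ge0 (1 - theta * (1 + lambda)); nra.
have ds : d <= s.
  rewrite -(@ler_pXn2r _ 2) ?nnegrE // d2 /s /jacobi_s -subr_ge0.
  have -> : (2 * theta * (1 + lambda - 2 * lambda * theta)) ^+ 2 -
    16 * theta ^+ 2 * (lambda * (1 - theta) * (1 - lambda * theta)) =
    (2 * theta * (1 - lambda)) ^+ 2 by ring.
  exact: sqr_ge0.
have d2s : d <= 2 - s.
  rewrite -(@ler_pXn2r _ 2) ?nnegrE // d2 /s /jacobi_s -subr_ge0.
  have -> : (2 - 2 * theta * (1 + lambda - 2 * lambda * theta)) ^+ 2 -
    16 * theta ^+ 2 * (lambda * (1 - theta) * (1 - lambda * theta)) =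
    (2 * (1 - (1 + lambda) * theta)) ^+ 2 by ring.
  exact: sqr_ge0.
by apply: mulr_ge0; nra.
Qed.

Lemma measurable_jacobi_density : measurable_fun setT jacobi_density.
Proof.
apply: measurable_funM; last exact: measurable_indic.
apply: measurable_funM => //; apply: measurable_funM.
  apply: measurableT_comp => /=.
    by apply: continuous_measurable_fun; exact: sqrt_continuous.
  by apply: measurable_funB => //; exact: measurable_funX.
apply: measurableT_comp => /=; first exact: measurable_inv.
apply: measurable_funB; first by apply: measurable_funD; exact: measurable_funM.
by apply: measurable_funM => //; exact: measurable_funX.
Qed.

Definition jacobi_measure (hl : 0 < lambda <= 1)
    (ht : 0 < theta <= (lambda + 1)^-1) :
    set (measurableTypeR R) -> \bar R :=
  fun A => (\int[lebesgue_measure]_(x in A) (jacobi_density x)%:E)%E.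

Context (hl : 0 < lambda <= 1) (ht : 0 < theta <= (lambda + 1)^-1).

Let nu0 : jacobi_measure hl ht set0 = 0%E.
Proof. by rewrite /jacobi_measure integral_set0. Qed.

Let nu_ge0 A : (0 <= jacobi_measure hl ht A)%E.
Proof. by apply: integral_ge0 => x _; rewrite lee_fin jacobi_density_ge0. Qed.

Let nu_sigma_additive : semi_sigma_additive (jacobi_measure hl ht).
Proof.
move=> /= F mF tF mUF; rewrite /jacobi_measure; apply: cvg_toP.
  apply: ereal_nondecreasing_is_cvgn => m n mn.
  apply: lee_sum_nneg_natr => // k _ _.
  by apply: integral_ge0 => /= x Fkx; rewrite lee_fin jacobi_density_ge0.
rewrite ge0_integral_bigcup//=.
- apply: measurable_funTS; apply: measurableT_comp => //.
  exact: measurable_jacobi_density.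
- by move=> x _; rewrite lee_fin jacobi_density_ge0.
Qed.

HB.instance Definition _ := isMeasure.Build _ _ _ (jacobi_measure hl ht)
  nu0 nu_ge0 nu_sigma_additive.

End free_jacobi.

(* Main.v *)
(* Up to a factor, the density of nu is the Bernstein-Szego weight
   sqrt(1 - x^2) / ((1 + p^2 + 2 p x) (1 + q^2 - 2 q x)) with 0 < p, q <= 1,
   q - p = 2 b and p q = 2 c - 1.  Let L be integration against nu.  Multiplying
   the weight by its denominator leaves the semicircle density, for which the U_n
   are orthogonal; since the denominator times U_n is
   Q_n - (q - p) Q_{n+1} - p q Q_{n+2}, this gives a second-order recurrence for
   L(Q_n), n >= 1.  Partial fractions and the value pi / 2 of the integral of
   sqrt(1 - x^2) / (1 + p^2 + 2 p x), which does not depend on p, give L(1) = 1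
   and L(Q_1) = L(Q_2) = 0, so L(Q_n) = 0 for every n >= 1.

   By the three-term recurrence of the monic P_n = Q_n / 2^n, this already yields
   the orthogonality relations and L(P_n^2) = omega_1 ... omega_n.  The same
   recurrence shows by induction on k that L(x^k P_n) is omega_1 ... omega_n times
   the Phi_n-coordinate of (a^+ + a + alpha_N)^k Phi_0; for n = 0 these are the
   moments of the vacuum distribution. *)

From HB Require Import structures.
Require Import Defs.
From mathcomp Require Import all_boot all_order all_algebra.
From mathcomp Require Import all_classical all_reals all_analysis.
From mathcomp Require Import measurable_realfun.
From mathcomp Require Import ring lra.

Set Implicit Arguments.
Unset Strict Implicit.
Unset Printing Implicit Defensive.

Import Order.TTheory GRing.Theory Num.Theory.
Import numFieldNormedType.Exports.
Local Open Scope classical_set_scope.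
Local Open Scope ring_scope.

(** * Three-term recurrences *)

Section favard.
Context (R : realType) (L : {poly R} -> R) (P : nat -> {poly R})
  (alpha omega : nat -> R).
Hypothesis L_scalar : scalar L.
Hypothesis recP : forall n, ('X - (alpha n)%:P) * P n =
  P n.+1 + omega n *: (if n is m.+1 then P m else 0).
Hypothesis P0 : P 0 = 1.
Hypothesis LP0 : L 1 = 1.
Hypothesis LPS : forall n, L (P n.+1) = 0.

Implicit Types p q : {poly R}.

Let linL : {scalar {poly R}} :=
  HB.pack L (GRing.isLinear.Build R {poly R} R *%R L L_scalar).

Lemma functionalD p q : L (p + q) = L p + L q.
Proof. exact: (raddfD linL). Qed.

Lemma functionalZ a p : L (a *: p) = a * L p.
Proof. exact: (linearZ_LR linL). Qed.

Lemma functional_sum n (F : 'I_n -> {poly R}) :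
  L (\sum_(i < n) F i) = \sum_(i < n) L (F i).
Proof. exact: (raddf_sum linL). Qed.

Lemma mulX_three_term n :
  'X * P n =
  P n.+1 + alpha n *: P n + omega n *: (if n is m.+1 then P m else 0).
Proof. by rewrite addrAC -recP mulrBl mul_polyC subrK. Qed.

Lemma three_term_monic_size n : P n \is monic /\ size (P n) = n.+1.
Proof.
(* The recurrence has order two, so the induction carries two consecutive indices. *)
suff: forall n, [/\ P n \is monic, size (P n) = n.+1, P n.+1 \is monic &
  size (P n.+1) = n.+2] by move=> /(_ n)[].
elim=> [|k [mk sk mSk sSk]].
  have -> : P 1%N = 'X - (alpha 0)%:P.
    by have := recP 0; rewrite P0 mulr1 scaler0 addr0.
  by rewrite P0 monic1 size_poly1 monicXsubC size_XsubC.
have P2 : P k.+2 = ('X - (alpha k.+1)%:P) * P k.+1 + (- omega k.+1) *: P k.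
  by rewrite recP scaleNr addrK.
have sM : size (('X - (alpha k.+1)%:P) * P k.+1) = k.+3.
  by rewrite size_monicM ?monicXsubC ?monic_neq0 // size_XsubC sSk.
have sZ : (size ((- omega k.+1) *: P k) < k.+3)%N.
  by rewrite (leq_ltn_trans (size_scale_leq _ _)) // sk.
split=> //; last by rewrite P2 size_polyDl ?sM.
rewrite monicE P2 lead_coefDl ?sM // lead_coefM (eqP (monicXsubC _)) mul1r.
exact/eqP/(eqP mSk).
Qed.

(** Multiplication by ['X] lowers the index by at most one, so ['X^k * P n] expands in the [P m]
    with [m >= n - k > 0], on which [L] vanishes. *)
Lemma functional_Xn_mul k n : (k < n)%N -> L ('X^k * P n) = 0.
Proof.
elim: k n => [|k IH] [|n] //; first by rewrite mul1r LPS.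
move=> kn; rewrite exprSr -mulrA mulX_three_term !mulrDr -!scalerAr.
rewrite !functionalD !functionalZ !IH ?mulr0 ?addr0 //.
  exact: ltnW.
exact/ltnW/ltnW.
Qed.

Lemma functional_mul_lower p n : (size p <= n)%N -> L (p * P n) = 0.
Proof.
move=> pn; rewrite -[p]coefK poly_def mulr_suml functional_sum big1 // => i _.
rewrite -scalerAl functionalZ functional_Xn_mul ?mulr0 //.
exact: leq_trans (ltn_ord i) pn.
Qed.

Lemma functional_orthogonal m n : m != n -> L (P m * P n) = 0.
Proof.
have sP k := (three_term_monic_size k).2.
by rewrite neq_ltn => /orP[mn|nm]; last rewrite mulrC;
  rewrite functional_mul_lower // sP.
Qed.

Lemma functional_square n : L (P n * P n) = \prod_(1 <= k < n.+1) omega k.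
Proof.
elim: n => [|n IH]; first by rewrite big_geq // P0 mulr1.
rewrite big_nat_recr //= -IH.
(* One factor [P n.+1] becomes ['X * P n] up to terms of degree at most [n], which [L] kills against
   the other factor. Moving ['X] onto that factor leaves only its component [omega n.+1 *: P n]. *)
have {1}-> : P n.+1 = 'X * P n + (- alpha n *: P n
   - omega n *: (if n is m.+1 then P m else 0)).
  rewrite mulX_three_term scaleNr.
  by move: (_ *: P n) (omega n *: _) => u v; ring.
rewrite mulrDl functionalD [X in _ + X]functional_mul_lower; last first.
  have sP k := (three_term_monic_size k).2.
  rewrite (leq_trans (size_polyD _ _)) // geq_max size_polyN.
  rewrite !(leq_trans (size_scale_leq _ _)) //; last by rewrite sP.
  by case: n {IH} => [|n]; rewrite ?size_poly0 // sP.
rewrite addr0 [X in L X](_ : _ = P n * ('X * P n.+1)); last by ring.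
rewrite mulX_three_term !mulrDr -!scalerAr !functionalD !functionalZ.
rewrite (@functional_orthogonal n n.+2) ?(@functional_orthogonal n n.+1);
  try by rewrite neq_ltn ?ltnS ?leqnn ?leqnSn.
by rewrite mulr0 !add0r mulrC.
Qed.

End favard.

(** * Recurrences of the polynomials [Q_n] *)

Section jacobi_polynomials.
Context (R : realType) (lambda theta : R).
Local Notation b := (jacobi_b lambda theta).
Local Notation c := (jacobi_c lambda theta).
Local Notation Q := (jacobi_Q lambda theta).

Lemma jacobi_Q0 : Q 0%N = 1.
Proof. by rewrite /jacobi_Q /= !scaler0 subr0 addr0. Qed.

Lemma jacobi_Q1 : Q 1%N = 2%:P * 'X - (2 * b)%:P.
Proof.
rewrite /jacobi_Q subrr chebU0 chebU1 /= scaler0 addr0.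
by rewrite -mul_polyC mulr1.
Qed.

Lemma jacobi_QSS n : Q n.+2 =
  chebU R n.+2 - (2 * b) *: chebU R n.+1 + (1 - 2 * c) *: chebU R n.
Proof.
rewrite /jacobi_Q.
have -> : n.+2%:Z - 2 = n by rewrite -addn2 PoszD addrK.
have -> : n.+2%:Z - 1 = n.+1 by rewrite -addn1 PoszD addrK.
by [].
Qed.

(** Continuing the Tchebycheff recurrence to [U_{-2} = -1] would turn [Q_0] into [2 c]; the
    convention [U_{-2} = 0] makes [Q_0 = 1] instead, whence the exceptional [omega_1]. *)
Lemma mulX_jacobi_Q n : 2 * 'X * Q n.+1 =
  Q n.+2 + (if n is m.+1 then Q n else (2 * c)%:P).
Proof.
case: n => [|[|n]]; rewrite ?jacobi_QSS ?jacobi_Q1 ?chebUSS ?chebU1 ?chebU0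
  -?mul_polyC; ring.
Qed.

Definition jacobi_monic (n : nat) : {poly R} := 2^-1 ^+ n *: Q n.

Lemma jacobi_monic_recurrence n :
  ('X - (jacobi_alpha lambda theta n)%:P) * jacobi_monic n =
  jacobi_monic n.+1 +
  jacobi_omega lambda theta n *: (if n is m.+1 then jacobi_monic m else 0).
Proof.
have half2 : 2^-1%:P * 2 = 1 :> {poly R}.
  by rewrite -(rmorph_nat (@polyC R)) -polyCM mulVf ?pnatr_eq0.
have four : 4^-1 = 2^-1 * 2^-1 :> R by rewrite -invfM -natrM.
rewrite /jacobi_monic; case: n => [|n].
  rewrite scaler0 addr0 expr0 scale1r jacobi_Q0 jacobi_Q1 expr1 mulr1.
  transitivity ((2^-1%:P * 2) * ('X - b%:P)); first by rewrite half2 mul1r.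
  by rewrite -mul_polyC; ring.
rewrite [jacobi_alpha _ _ _]/= subr0 !exprS -!mul_polyC !polyCM.
have -> : 'X * (2^-1%:P * (2^-1 ^+ n)%:P * Q n.+1) =
    2^-1%:P * (2^-1 ^+ n)%:P * (2^-1%:P * (2 * 'X * Q n.+1)).
  by rewrite -!mulrA (mulrA 2^-1%:P 2) half2 mul1r; ring.
rewrite mulX_jacobi_Q.
case: n => [|n]; rewrite /jacobi_omega /=; last by rewrite four; ring.
have -> : (2 * c)%:P = 2 * c%:P :> {poly R} by ring.
rewrite jacobi_Q0 !(mulrDr _ (Q 2%N)) (mulrA 2^-1%:P 2) half2.
by rewrite polyCM; ring.
Qed.

(* At x = cos(phi) and z = exp(i phi), the product of the two factors is
   |(1 + p z) (1 - q z)|^2, and Q_n(x) sin(phi) is the imaginary part of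
   z^(n+1) times the conjugate of (1 + p z) (1 - q z).  For n = 0 this holds only
   if U_{-2} is -1, as in the recurrence, hence the exceptional 1 + p q. *)
Lemma jacobi_Q_bernstein p q (n : nat) :
  2 * b = q - p -> 1 - 2 * c = - (p * q) ->
  ((1 + p ^+ 2)%:P + (2 * p) *: 'X) * ((1 + q ^+ 2)%:P - (2 * q) *: 'X)
    * chebU R n =
  (if n is 0 then (1 + p * q)%:P else Q n) - (q - p) *: Q n.+1
  - (p * q) *: Q n.+2.
Proof.
move=> hb hc; case: n => [|[|n]]; rewrite !(jacobi_QSS, jacobi_Q1, jacobi_Q0);
  rewrite hb hc !chebUSS ?chebU1 ?chebU0 -!mul_polyC; ring.
Qed.

End jacobi_polynomials.

(** * Semicircle integrals *)

Section semicircle.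
Context {R : realType}.
Local Notation mu := (@lebesgue_measure R).

Lemma cos_itvN11 (a : R) : cos a \in `[-1, 1].
Proof. by rewrite in_itv /= cos_geN1 cos_le1. Qed.

Lemma derive1_cos : derive1 (@cos R) = (fun a => - sin a).
Proof. by apply/funext => a; rewrite derive1E; apply: derive_val. Qed.

(** The substitution [x = cos a], decreasing on [[0, pi]], turns [sqrt (1 - x^2) dx] into
    [sin a ^+ 2 da]. *)
Lemma integral_semicircle (g F : R -> R) :
  {in `[-1, 1], forall x, {for x, continuous g}} ->
  (forall a : R, is_derive a 1 F (g (cos a) * sin a ^+ 2)) ->
  (\int[mu]_(x in `[(-1)%R, 1%R]) (Num.sqrt (1 - x ^+ 2) * g x)%:E =
   (F pi - F 0)%:E)%E.
Proof.
move=> cg dF.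
pose f x := Num.sqrt (1 - x ^+ 2) * g x.
have csin : continuous (fun a : R => - sin a).
  by move=> a; apply: cvgN; exact: continuous_sin.
have := @integration_by_substitution_decreasing R cos f 0 pi (pi_ge0 R).
rewrite cospi cos0 derive1_cos => ->.
- transitivity (\int[mu]_(x in `[0%R, pi]) (g (cos x) * sin x ^+ 2)%:E)%E.
    apply: eq_integral => a; rewrite inE /= in_itv /= => a0pi.
    congr (_%:E); transitivity (f (cos a) * - - sin a) => //.
    by rewrite /f -sin2cos2 sqrtr_sqr ger0_norm ?sin_ge0_pi //; ring.
  rewrite (@continuous_FTC2 _ _ F) ?pi_gt0 //.
  + apply: continuous_subspaceT => a; apply: cvgM.
      apply: continuous_comp; first exact: continuous_cos.
      exact/cg/cos_itvN11.
    rewrite expr2; under eq_fun do rewrite expr2.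
    by apply: cvgM; exact: continuous_sin.
  + have cF : continuous F.
      by move=> a; apply/differentiable_continuous/derivable1_diffP.
    split=> [a _||]; first exact: ex_derive.
      by apply: cvg_at_right_filter; exact: cF.
    by apply: cvg_at_left_filter; exact: cF.
  + by move=> a _; rewrite derive1E; apply: derive_val.
- by move=> x y x0 y0 xy; rewrite ltr_cos.
- by move=> a _; exact: csin.
- by apply/cvg_ex; exists (- sin 0); apply: cvg_at_right_filter; exact: csin.
- by apply/cvg_ex; exists (- sin pi); apply: cvg_at_left_filter; exact: csin.
- split=> [a _||]; first exact: ex_derive.
    by apply: cvg_at_right_filter; exact: continuous_cos.
  by apply: cvg_at_left_filter; exact: continuous_cos.
- apply: continuous_in_subspaceT => x; rewrite inE /= => x11.
  apply: cvgM; last exact: cg.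
  apply: continuous_comp; last exact: sqrt_continuous.
  apply: cvgB; first exact: cvg_cst.
  by rewrite expr2; under eq_fun do rewrite expr2; apply: cvgM.
Qed.

(** The factor [sin a ^+ 2] coming from the substitution makes the formula valid also where
    [sin a = 0]. *)
Lemma chebU_cos_mul_sin (n : nat) (a : R) :
  (chebU R n).[cos a] * sin a ^+ 2 = sin (n.+1%:R * a) * sin a.
Proof.
have [->|sa0] := eqVneq (sin a) 0; first by rewrite expr0n !mulr0.
by rewrite chebU_cos // expr2 mulrA mulfVK.
Qed.

Lemma is_derive_sin_scale (k a : R) :
  is_derive a 1 (fun x => sin (k * x)) (k * cos (k * a)).
Proof.
have dk : is_derive a 1 (fun x : R => k * x) k.
  by apply: is_derive_eq; rewrite /GRing.scale /= mulr1.
by rewrite mulrC; exact: (is_derive1_comp (is_derive_sin _) dk).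
Qed.

Lemma integral_chebU_semicircle (n : nat) :
  (\int[mu]_(x in `[(-1)%R, 1%R])
     (Num.sqrt (1 - x ^+ 2) * (chebU R n).[x])%:E =
   (if n is 0 then pi / 2 else 0)%:E)%E.
Proof.
(* A primitive of [(cos (n a) - cos ((n + 2) a)) / 2]. For [n = 0] the first cosine is constant, and
   its primitive [a] gives the only nonzero value. *)
pose F a : R := 2^-1 * ((if n is 0 then a else n%:R^-1 * sin (n%:R * a)) -
  n.+2%:R^-1 * sin (n.+2%:R * a)).
have dF (a : R) : is_derive a 1 F ((chebU R n).[cos a] * sin a ^+ 2).
  rewrite chebU_cos_mul_sin.
  have -> : sin (n.+1%:R * a) * sin a =
      2^-1 * (cos (n%:R * a) - cos (n.+2%:R * a)).
    have -> : n%:R * a = n.+1%:R * a - a by rewrite -[n.+1]addn1 natrD; ring.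
    have -> : n.+2%:R * a = n.+1%:R * a + a by rewrite -[n.+2]addn1 natrD; ring.
    by rewrite cosB cosD; field.
  have ds (k : nat) : is_derive a 1
      (fun x : R => k.+1%:R^-1 * sin (k.+1%:R * x)) (cos (k.+1%:R * a)).
    have dk := is_derive_sin_scale k.+1%:R a.
    by apply: is_derive_eq; rewrite /GRing.scale /= mulKf ?pnatr_eq0.
  rewrite /F; case: n {F} => [|n].
    have d0 := ds 1%N.
    by apply: is_derive_eq; rewrite /GRing.scale /= mul0r cos0.
  have d1 := ds n.+2; have d0 := ds n.
  by apply: is_derive_eq; rewrite /GRing.scale /=.
rewrite (integral_semicircle _ dF); last first.
  by move=> x _; exact: continuous_horner.
have sin_nat k : sin (k%:R * pi) = 0 :> R.
  elim: k => [|k IH]; first by rewrite mul0r sin0.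
  by rewrite -natr1 mulrDl mul1r sinDpi IH oppr0.
rewrite /F; case: n {F dF} => [|n];
  rewrite ?mulr0 sin0 !sin_nat; congr (_%:E); ring.
Qed.

Lemma poisson_denominator_gt0 (p x : R) : 0 < `|p| < 1 -> -1 <= x <= 1 ->
  0 < 1 + p ^+ 2 + 2 * p * x.
Proof.
move=> /andP[p0 p1] /andP[x0 x1].
(* The expression is [(1 - p)^2 + 2 p (1 + x)], and also [(1 + p)^2 - 2 p (1 - x)], to be used when
   [p < 0]. *)
have [pp|pn] := ger0P p;
  [rewrite (ger0_norm pp) in p0 p1|rewrite (ltr0_norm pn) in p0 p1].
  by have : 0 <= p * (x + 1) by [nra]; nra.
by have : 0 <= (- p) * (1 - x) by [nra]; nra.
Qed.

Lemma integral_poisson_semicircle_lt1 (p : R) : 0 < `|p| < 1 ->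
  (\int[mu]_(x in `[(-1)%R, 1%R])
     (Num.sqrt (1 - x ^+ 2) * (1 + p ^+ 2 + 2 * p * x)^-1)%:E = (pi / 2)%:E)%E.
Proof.
move=> p01; have p0 : p != 0 by rewrite -normr_gt0; case/andP: p01.
(* [F] is a primitive of half the real part of (1 - z^2) / (1 + p z), where
   z = exp(i a), and [atan (T a)] is the argument of 1 + p z. *)
pose T a := p * sin a * (1 + p * cos a)^-1.
pose F a : R := 2^-1 * (a - p^-1 * sin a + (p ^- 2 - 1) * atan (T a)).
have dF (a : R) :
    is_derive a 1 F ((1 + p ^+ 2 + 2 * p * cos a)^-1 * sin a ^+ 2).
  have s2 : sin a ^+ 2 = 1 - cos a ^+ 2 by rewrite -(cos2Dsin2 a); ring.
  (* The real part of [1 + p z] never vanishes, as [|p| < 1]; hence [T] is differentiable at every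
     [a]. *)
  have pc : 1 + p * cos a != 0.
    have [ca0 ca1] := (cos_geN1 a, cos_le1 a).
    have : `|p * cos a| < 1.
      rewrite normrM; case/andP: p01 => _; apply: le_lt_trans.
      by rewrite ler_piMr // ler_norml ca0.
    by rewrite ltr_norml => /andP[]; lra.
  have D0 : 1 + p ^+ 2 + 2 * p * cos a != 0.
    by rewrite gt_eqF // poisson_denominator_gt0 // cos_geN1 cos_le1.
  have dV : is_derive a 1 (fun x : R => (1 + p * cos x)^-1)
      (- (1 + p * cos a) ^- 2 *: (p * - sin a)).
    apply: is_deriveV => //; apply: is_derive_eq.
    by rewrite /GRing.scale /= add0r mul1r.
  have dT : is_derive a 1 T (p * (cos a + p) / (1 + p * cos a) ^+ 2).
    apply: is_derive_eq; rewrite /GRing.scale /=.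
    transitivity ((p ^+ 2 * sin a ^+ 2 + p * cos a * (1 + p * cos a)) /
      (1 + p * cos a) ^+ 2); first by field.
    by rewrite s2; congr (_ / _); ring.
  have datan : is_derive a 1 (atan \o T)
      (p * (cos a + p) / (1 + p ^+ 2 + 2 * p * cos a)).
    apply: (is_derive_eq (is_derive1_comp (is_derive1_atan (T a)) dT)).
    have -> : 1 + T a ^+ 2 =
        (1 + p ^+ 2 + 2 * p * cos a) / (1 + p * cos a) ^+ 2.
      transitivity (((1 + p * cos a) ^+ 2 + p ^+ 2 * sin a ^+ 2) /
        (1 + p * cos a) ^+ 2); first by rewrite /T; field.
      by rewrite s2; congr (_ / _); ring.
    by field; rewrite pc D0.
  rewrite s2.
  have -> : F = (fun x : R =>
      2^-1 * (x - p^-1 * sin x + (p ^- 2 - 1) * (atan \o T) x)) by [].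
  apply: is_derive_eq; rewrite /GRing.scale /=.
  by field; rewrite p0 D0.
rewrite (integral_semicircle (g := fun x => (1 + p ^+ 2 + 2 * p * x)^-1) _ dF).
(* At 0 and [pi] both [sin] and [T] vanish: only the term [a / 2] of [F] survives, whence a value
   free of [p]. *)
- rewrite /F /T sin0 sinpi !(mulr0, mul0r) atan0; congr (_%:E); ring.
- move=> x; rewrite in_itv /= => x11; apply: cvgV.
    by rewrite gt_eqF // poisson_denominator_gt0.
  apply: cvgD; first exact: cvg_cst.
  by apply: cvgM; first exact: cvg_cst.
Qed.
End semicircle.

(** * Poisson-type semicircle integrals, including [|p| = 1] *)

Section poisson.
Context {R : realType}.
Local Notation mu := (@lebesgue_measure R).

Local Notation I := (`[(-1)%R, 1%R]%classic : set R).

(** For [x = cos a] the inverted factor is [|1 + p e^(ia)|^2]; its inverse is a Poisson kernel up to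
    the factor [1 - p^2]. *)
Definition poisson_semicircle (p x : R) : R :=
  Num.sqrt (1 - x ^+ 2) * (1 + p ^+ 2 + 2 * p * x)^-1.

Lemma measurable_poisson_semicircle (p : R) :
  measurable_fun setT (poisson_semicircle p).
Proof.
apply: measurable_funM.
  apply: measurableT_comp => /=.
    by apply: continuous_measurable_fun; exact: sqrt_continuous.
  by apply: measurable_funB => //; exact: measurable_funX.
apply: measurableT_comp => /=; first exact: measurable_inv.
by apply: measurable_funD => //; exact: measurable_funM.
Qed.

Lemma poisson_denominator_ge0 (p x : R) : `|p| <= 1 -> -1 <= x <= 1 ->
  0 <= 1 + p ^+ 2 + 2 * p * x.
Proof.
rewrite ler_norml => /andP[p0 p1] /andP[x0 x1].
have [pp|pn] := ger0P p.
  by have : 0 <= p * (x + 1) by [nra]; nra.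
by have : 0 <= (- p) * (1 - x) by [nra]; nra.
Qed.

Lemma poisson_semicircle_ge0 (p x : R) : `|p| <= 1 -> -1 <= x <= 1 ->
  0 <= poisson_semicircle p x.
Proof.
move=> p1 x11.
by rewrite mulr_ge0 ?sqrtr_ge0 // invr_ge0 poisson_denominator_ge0.
Qed.

(* For p = 1 or p = -1 the integrand is unbounded at an endpoint; it is the
   increasing limit of the scaled integrands t / (1 + t^2 + 2 t p x) =
   1 / (t + 1 / t + 2 p x) as t increases to 1. *)
Lemma integral_poisson_semicircle (p : R) : 0 < `|p| <= 1 ->
  (\int[mu]_(x in `[(-1)%R, 1%R]) (poisson_semicircle p x)%:E = (pi / 2)%:E)%E.
Proof.
move=> /andP[p0]; rewrite le_eqVlt => /predU1P[p1|p1]; last first.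
  by apply: integral_poisson_semicircle_lt1; rewrite p0 p1.
have p2 : p ^+ 2 = 1 by rewrite -real_normK ?num_real // p1 expr1n.
(* [harmonic n] is [1 / (n + 1)]; halving it makes [t 0 = 1 / 2], so that [t n * p] is never 0. *)
pose t (n : nat) : R := 1 - harmonic n / 2.
have h0 n : 0 < harmonic n :> R by rewrite /harmonic invr_gt0.
have h1 n : harmonic n <= 1 :> R by rewrite /harmonic invf_le1 // ler1n.
have t01 n : 0 < t n < 1.
  by rewrite /t; have := h0 n; have := h1 n; lra.
have t_nd m n : (m <= n)%N -> t m <= t n.
  move=> mn; rewrite /t lerD2l lerN2 ler_pM2r ?invr_gt0 // /harmonic.
  by rewrite lef_pV2 ?posrE // ler_nat.
have t_cvg : t n @[n --> \oo] --> (1 : R).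
  rewrite -[X in _ --> X]subr0 -[X in 1 - X](mul0r 2^-1).
  apply: cvgB; first exact: cvg_cst.
  by apply: cvgM; [exact: cvg_harmonic | exact: cvg_cst].
have tp n : `|t n * p| = t n.
  by rewrite normrM p1 mulr1 gtr0_norm //; case/andP: (t01 n).
have tp1 n : 0 < `|t n * p| < 1 by rewrite tp.
have den_gt0 n x : -1 <= x <= 1 -> 0 < 1 + (t n * p) ^+ 2 + 2 * (t n * p) * x.
  by move=> x11; rewrite poisson_denominator_gt0.
pose g n x := (t n * poisson_semicircle (t n * p) x)%:E.
have mg n : measurable_fun I (g n).
  apply: measurable_funTS; apply/measurable_EFinP; apply: measurable_funM => //.
  exact: measurable_poisson_semicircle.
have itvP x : I x -> -1 <= x <= 1 by rewrite /= in_itv.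
have g_ge0 n x : I x -> (0 <= g n x)%E.
  move=> /itvP x11; case/andP: (t01 n) => /ltW t0 /ltW t1.
  by rewrite lee_fin mulr_ge0 // poisson_semicircle_ge0 // tp.
have g_nd x : I x ->
    {homo g ^~ x : m n / (m <= n)%N >-> (m <= n)%E}.
  move=> /itvP x11 m n mn; rewrite lee_fin /poisson_semicircle.
  rewrite mulrCA [leRHS]mulrCA ler_wpM2l ?sqrtr_ge0 //.
  rewrite ler_pdivrMr ?den_gt0 // mulrAC ler_pdivlMr ?den_gt0 //.
  rewrite !exprMn p2; have := t_nd _ _ mn.
  case/andP: (t01 m) => m0 m1; case/andP: (t01 n) => n0 n1 tmn.
  (* After cross-multiplication the terms in [x] cancel. *)
  rewrite -subr_ge0 (_ : _ - _ = (t n - t m) * (1 - t m * t n)); last by ring.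
  by rewrite mulr_ge0 ?subr_ge0 // mulr_ile1 // ltW.
have g_cvg x : I x ->
    limn (g ^~ x) = (poisson_semicircle p x)%:E.
  move=> /itvP x11; apply/cvg_lim => //; apply: cvg_EFin; first exact: nearW.
  rewrite /g /=.
  (* The limiting denominator [2 + 2 p x] vanishes at one endpoint; at both endpoints the square
     root is 0, so the sequence is constantly 0. *)
  have [x21|x21] := eqVneq (x ^+ 2) 1.
    rewrite /poisson_semicircle x21 subrr sqrtr0 mul0r.
    under eq_fun do rewrite mul0r mulr0.
    exact: cvg_cst.
  rewrite -[X in _ --> X]mul1r; apply: cvgM => //.
  apply: cvgM; first exact: cvg_cst.
  have tpc : t n * p @[n --> \oo] --> p.
    by rewrite -[X in _ --> X]mul1r; apply: cvgM => //; exact: cvg_cst.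
  apply: cvgV.
    rewrite p2; apply: contraNN x21 => /eqP px.
    have pxN1 : p * x = - 1 by lra.
    by rewrite -[x ^+ 2]mul1r -p2 -exprMn pxN1 sqrrN expr1n p2.
  apply: cvgD; last first.
    by apply: cvgM; last exact: cvg_cst; apply: cvgM => //; exact: cvg_cst.
  apply: cvgD; first exact: cvg_cst.
  by rewrite expr2; under eq_fun do rewrite expr2; apply: cvgM.
have cv :=
  @cvg_monotone_convergence _ _ R mu I (measurable_itv _) g mg g_ge0 g_nd.
have <- : (\int[mu]_(x in I) limn (g ^~ x) =
    \int[mu]_(x in I) (poisson_semicircle p x)%:E)%E.
  by apply: eq_integral => x; rewrite inE => xI; rewrite g_cvg.
rewrite -(cvg_lim _ cv) //; apply/cvg_lim => //.
have -> : (fun n => \int[mu]_(x in I) g n x)%E = (fun n => (t n * (pi / 2))%:E).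
  apply/funext => n; rewrite /g; under eq_integral do rewrite EFinM.
  rewrite ge0_integralZl_EFin //.
  - by rewrite EFinM; congr (_ * _)%E; exact: integral_poisson_semicircle_lt1.
  - move=> x /itvP x11; case/andP: (t01 n) => _ /ltW t1.
    by rewrite lee_fin poisson_semicircle_ge0 // tp.
  - apply: measurable_funTS; apply/measurable_EFinP.
    exact: measurable_poisson_semicircle.
  - by case/andP: (t01 n) => /ltW.
apply: cvg_EFin; first exact: nearW.
by rewrite -[X in _ --> X]mul1r; apply: cvgM => //; exact: cvg_cst.
Qed.
End poisson.

(** * Measures with a density *)

Section density.
Context d (T : measurableType d) (R : realType).
Context (mu nu : {measure set T -> \bar R}) (w : T -> R).
Hypothesis w_ge0 : forall x, 0 <= w x.
Hypothesis mw : measurable_fun setT w.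
Hypothesis nuE : forall A, measurable A ->
  nu A = (\int[mu]_(x in A) (w x)%:E)%E.

Import HBNNSimple.

(** A simple function is a finite combination of indicators of its level sets, and [nuE] applies to
    each of these. *)
Let integral_density_nnsfun (h : {nnsfun T >-> R}) :
  (\int[nu]_x (h x)%:E = \int[mu]_x (h x * w x)%:E)%E.
Proof.
under eq_integral do rewrite fimfunE -fsumEFin//.
rewrite ge0_integral_fsum//; last 2 first.
  - by move=> r; exact/measurable_EFinP/measurableT_comp.
  - by move=> n x _; rewrite EFinM nnfun_muleindic_ge0.
transitivity (\int[mu]_x (\sum_(y \in range h)
    (y * \1_(h @^-1` [set y]) x)%:E * (w x)%:E))%E; last first.
  apply: eq_integral => x _.
  rewrite -ge0_mule_fsuml => [|y]; last exact: nnfun_muleindic_ge0.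
  by rewrite fsumEFin // -fimfunE EFinM.
rewrite ge0_integral_fsum//; last 2 first.
  - move=> r; apply: emeasurable_funM; last exact/measurable_EFinP.
    by apply/measurable_EFinP/measurableT_comp.
  - by move=> r x _; apply: mule_ge0;
      [exact: nnfun_muleindic_ge0 | rewrite lee_fin].
apply: eq_fsbigr => r; rewrite inE => -[t _ <-].
have mr : measurable (h @^-1` [set h t]) by exact: measurable_funPTI.
rewrite integralZl_indic_nnsfun // integral_indic // setIT nuE //.
under [RHS]eq_integral do rewrite EFinM -muleA.
rewrite ge0_integralZl_EFin //.
- congr (_ * _)%E; rewrite integral_mkcond; apply: eq_integral => x _.
  by rewrite patchE indicE; case: ifPn; rewrite ?mul1e ?mul0e.
- by move=> x _; rewrite mule_ge0 // lee_fin.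
- by apply: emeasurable_funM; exact/measurable_EFinP.
Qed.

(** Monotone convergence, under both measures, along simple functions increasing to [f]. *)
Lemma ge0_integral_density (f : T -> \bar R) :
  measurable_fun setT f -> (forall x, 0 <= f x)%E ->
  (\int[nu]_x f x = \int[mu]_x (f x * (w x)%:E))%E.
Proof.
move=> mf f0; pose h := nnsfun_approx measurableT mf.
have hx x : EFin (h n x) @[n --> \oo] --> f x by exact: cvg_nnsfun_approx.
have h_nd x m n : (m <= n)%N -> (h m x <= h n x)%R.
  by move=> mn; exact/lefP/nd_nnsfun_approx.
transitivity (limn (fun n => \int[nu]_x (h n x)%:E))%E.
  rewrite -monotone_convergence //=.
  - by apply: eq_integral => x _; apply/esym/cvg_lim.
  - by move=> n; exact/measurable_EFinP.
  - by move=> n x _; rewrite lee_fin.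
  - by move=> x _ m n mn; rewrite lee_fin; exact: h_nd.
under eq_fun do rewrite integral_density_nnsfun.
rewrite -monotone_convergence //=.
- apply: eq_integral => x _; apply/cvg_lim => //.
  under eq_fun do rewrite EFinM.
  by apply: cvgeZr.
- by move=> n; apply/measurable_EFinP; exact: measurable_funM.
- by move=> n x _; rewrite lee_fin mulr_ge0.
- by move=> x _ m n mn; rewrite lee_fin ler_wpM2r // h_nd.
Qed.

Lemma integrable_density (f : T -> R) : measurable_fun setT f ->
  mu.-integrable setT (fun x => (f x * w x)%:E) ->
  nu.-integrable setT (EFin \o f).
Proof.
move=> /measurable_EFinP mf /integrableP[_ fi]; apply/integrableP; split=> //.
rewrite ge0_integral_density //; last exact/measurableT_comp.
apply: le_lt_trans fi; rewrite le_eqVlt; apply/orP; left; apply/eqP.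
by apply: eq_integral => x _ /=; rewrite normrM (ger0_norm (w_ge0 x)) EFinM.
Qed.

(** Since [w >= 0], multiplication by [w] commutes with positive and negative parts, which reduces
    the claim to the nonnegative case. *)
Lemma Rintegral_density (f : T -> R) : measurable_fun setT f ->
  \int[nu]_x f x = \int[mu]_x (f x * w x).
Proof.
move=> mf; rewrite /Rintegral; congr fine.
rewrite [LHS]integralE [RHS]integralE.
have mf' : measurable_fun setT (EFin \o f) by exact/measurable_EFinP.
congr (_ - _)%E; rewrite ge0_integral_density //.
- apply: eq_integral => x _; rewrite !funeposE -!EFin_max -EFinM.
  by rewrite maxr_pMl // mul0r.
- exact: measurable_funepos.
- apply: eq_integral => x _; rewrite !funenegE -!EFinN -!EFin_max -EFinM.
  by rewrite maxr_pMl // mul0r mulNr.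
- exact: measurable_funeneg.
Qed.
End density.

(** * Bernstein-Szego weights *)

Section bernstein_szego.
Context {R : realType} (p q : R).
Hypotheses (p01 : 0 < p <= 1) (q01 : 0 < q <= 1).
Local Notation mu := (@lebesgue_measure R).
Local Notation I := (`[(-1)%R, 1%R]%classic : set R).
Local Notation F := ((1 + p ^+ 2)%:P + (2 * p) *: 'X).
Local Notation G := ((1 + q ^+ 2)%:P - (2 * q) *: 'X).

Let p_norm : 0 < `|p| <= 1.
Proof. by case/andP: p01 => p0 p1; rewrite gtr0_norm // p0. Qed.

Let q_norm : 0 < `|- q| <= 1.
Proof.
by case/andP: q01 => q0 q1; rewrite normrN gtr0_norm // q0.
Qed.

Let pq_gt0 : 0 < 1 + p * q.
Proof.
case/andP: p01 => p0 _; case/andP: q01 => q0 _.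
by have := mulr_gt0 p0 q0; lra.
Qed.

Let pDq_gt0 : 0 < p + q.
Proof. by case/andP: p01 => p0 _; case/andP: q01 => q0 _; lra. Qed.

Definition bernstein_weight (x : R) : R :=
  Num.sqrt (1 - x ^+ 2) *
  ((1 + p ^+ 2 + 2 * p * x) * (1 + q ^+ 2 - 2 * q * x))^-1.

Lemma horner_left_factor x : F.[x] = 1 + p ^+ 2 + 2 * p * x.
Proof. by rewrite !hornerE. Qed.

Lemma horner_right_factor x : G.[x] = 1 + q ^+ 2 - 2 * q * x.
Proof. by rewrite !hornerE. Qed.

(* At x = 1 or x = -1 a denominator may vanish, but so does the square root, and
   division by 0 gives 0: the identities below hold on the closed interval. *)
Lemma bernstein_weight_boundary x : x ^+ 2 = 1 -> bernstein_weight x = 0.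
Proof. by move=> x21; rewrite /bernstein_weight x21 subrr sqrtr0 mul0r. Qed.

Lemma poisson_semicircle_boundary (r x : R) :
  x ^+ 2 = 1 -> poisson_semicircle r x = 0.
Proof. by move=> x21; rewrite /poisson_semicircle x21 subrr sqrtr0 mul0r. Qed.

(** The factors are [(1 - p)^2 + 2 p (1 + x)] and [(1 - q)^2 + 2 q (1 - x)], whose last terms are
    positive for [-1 < x < 1]. *)
Lemma bernstein_denominators_neq0 x : I x -> x ^+ 2 != 1 ->
  (1 + p ^+ 2 + 2 * p * x != 0) /\ (1 + q ^+ 2 - 2 * q * x != 0).
Proof.
rewrite /= in_itv /= => /andP[x0 x1] x2.
have {x2} /andP[x0' x1'] : -1 < x < 1.
  rewrite !lt_neqAle x0 x1 !andbT; apply/andP; split.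
    by apply: contraNneq x2 => <-; rewrite sqrrN expr1n.
  by apply: contraNneq x2 => ->; rewrite expr1n.
case/andP: p01 => p0 p1; case/andP: q01 => q0 q1.
have sq (r : R) : 1 + r ^+ 2 - 2 * r = (1 - r) ^+ 2 by ring.
split; rewrite gt_eqF //.
  have : 0 < p * (1 + x) by rewrite mulr_gt0 //; lra.
  by have := sq p; have := sqr_ge0 (1 - p); nra.
have : 0 < q * (1 - x) by rewrite mulr_gt0 //; lra.
by have := sq q; have := sqr_ge0 (1 - q); nra.
Qed.

(** Rests on [p (1 + q^2 - 2 q x) + q (1 + p^2 + 2 p x) = (p + q) (1 + p q)], where [x] cancels. *)
Lemma bernstein_weight_partial_fraction x : I x ->
  bernstein_weight x = ((p + q) * (1 + p * q))^-1 *
    (p * poisson_semicircle p x + q * poisson_semicircle (- q) x).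
Proof.
move=> xI; have [x2|x2] := eqVneq (x ^+ 2) 1.
  rewrite bernstein_weight_boundary // !poisson_semicircle_boundary //.
  by rewrite !mulr0 addr0 mulr0.
have [Fx Gx] := bernstein_denominators_neq0 xI x2.
rewrite /bernstein_weight /poisson_semicircle sqrrN mulrN mulNr.
have := gt_eqF pq_gt0; have := gt_eqF pDq_gt0 => /negbT h1 /negbT h2.
by field; rewrite ?Fx ?Gx ?h1 ?h2.
Qed.

(** Gives a second explicit integral besides the total mass; the mean is deduced from the two. *)
Lemma mulF_bernstein_weight x : I x ->
  F.[x] * bernstein_weight x = poisson_semicircle (- q) x.
Proof.
move=> xI; have [x2|x2] := eqVneq (x ^+ 2) 1.
  by rewrite bernstein_weight_boundary // poisson_semicircle_boundary // mulr0.
have [Fx Gx] := bernstein_denominators_neq0 xI x2.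
rewrite horner_left_factor /bernstein_weight /poisson_semicircle.
rewrite sqrrN mulrN mulNr.
by field; rewrite ?Fx ?Gx.
Qed.

Lemma mulFG_bernstein_weight x : I x ->
  (F * G).[x] * bernstein_weight x = Num.sqrt (1 - x ^+ 2).
Proof.
move=> xI; have [x2|x2] := eqVneq (x ^+ 2) 1.
  by rewrite bernstein_weight_boundary // mulr0 x2 subrr sqrtr0.
have [Fx Gx] := bernstein_denominators_neq0 xI x2.
rewrite hornerM horner_left_factor horner_right_factor /bernstein_weight.
by field; rewrite ?Fx ?Gx.
Qed.

(** The integrand is nonnegative on [I], so its known finite integral is that of its absolute value;
    this covers the unbounded case [|r| = 1]. *)
Lemma integrable_poisson_semicircle (r : R) : 0 < `|r| <= 1 ->
  mu.-integrable I (EFin \o poisson_semicircle r).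
Proof.
move=> r01; apply/integrableP; split.
  apply: measurable_funTS; apply/measurable_EFinP.
  exact: measurable_poisson_semicircle.
rewrite (_ : (\int[mu]_(x in I) _)%E = (pi / 2)%:E) ?ltry //.
rewrite -(@integral_poisson_semicircle _ r) //; apply: eq_integral => x.
rewrite inE /= in_itv /= => x11; rewrite ger0_norm //.
by apply: poisson_semicircle_ge0 => //; case/andP: r01.
Qed.

Lemma integrable_bernstein_weight : mu.-integrable I (EFin \o bernstein_weight).
Proof.
apply: (@eq_integrable _ _ _ mu I _
  (fun x => ((p + q) * (1 + p * q))^-1%:E * (p%:E * (poisson_semicircle p x)%:E
    + q%:E * (poisson_semicircle (- q) x)%:E))%E) => //.
  by move=> x; rewrite inE => xI; rewrite /= bernstein_weight_partial_fraction.
apply: integrableZl => //; apply: integrableD => //; apply: integrableZl => //;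
  exact: integrable_poisson_semicircle.
Qed.

Lemma integrable_mul_bernstein_weight (f : {poly R}) :
  mu.-integrable I (fun x => (f.[x] * bernstein_weight x)%:E).
Proof.
have cf : continuous (horner f) by exact: continuous_horner.
apply: (@integrableMr _ _ _ mu I _ (horner f) (EFin \o bernstein_weight)) => //.
- by apply: measurable_funTS; exact: continuous_measurable_fun.
- have /compact_bounded[M [_ fM]] :=
    continuous_compact (continuous_subspaceT cf) (@segment_compact R (-1) 1).
  exists M; split; rewrite ?num_real // => y My x xI.
  by apply: (fM y My); exists x.
- exact: integrable_bernstein_weight.
Qed.

Definition bernstein_moment (f : {poly R}) : R :=
  \int[mu]_(x in I) (f.[x] * bernstein_weight x).

Lemma bernstein_moment_scalar : scalar bernstein_moment.
Proof.
move=> a f g; rewrite /bernstein_moment -RintegralZl //; last first.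
  exact: integrable_mul_bernstein_weight.
rewrite -RintegralD //; last exact: integrable_mul_bernstein_weight.
  by apply: eq_Rintegral => x _; rewrite hornerD hornerZ; ring.
have := integrable_mul_bernstein_weight (a *: f).
by apply: eq_integrable => // x _; rewrite /= hornerZ -[RHS]/(_%:E) -mulrA.
Qed.

Lemma bernstein_moment1 : bernstein_moment 1 = pi / 2 / (1 + p * q).
Proof.
have iZ (c r : R) : 0 < `|r| <= 1 ->
    mu.-integrable I (EFin \o (fun x => c * poisson_semicircle r x)).
  by move=> /integrable_poisson_semicircle; exact: integrableZl.
have R1 (r : R) : 0 < `|r| <= 1 ->
    \int[mu]_(x in I) poisson_semicircle r x = pi / 2.
  by move=> r01; rewrite /Rintegral integral_poisson_semicircle.
transitivity
  (((p + q) * (1 + p * q))^-1 * (p * (pi / 2) + q * (pi / 2))); last first.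
  by field; rewrite !gt_eqF.
rewrite -{1}(R1 p) // -(R1 (- q)) // -!RintegralZl //;
  try exact: integrable_poisson_semicircle.
rewrite -RintegralD // -?RintegralZl //; try exact: iZ.
  2: by apply: (integrableD _ (iZ p p p_norm) (iZ q (- q) q_norm));
    exact: measurable_itv.
apply: eq_Rintegral => x; rewrite inE => xI.
by rewrite hornerC mul1r bernstein_weight_partial_fraction.
Qed.

Lemma bernstein_moment_linear_factor : bernstein_moment F = pi / 2.
Proof.
rewrite /bernstein_moment /Rintegral.
have -> : (\int[mu]_(x in I) (F.[x] * bernstein_weight x)%:E =
    \int[mu]_(x in I) (poisson_semicircle (- q) x)%:E)%E.
  by apply: eq_integral => x; rewrite inE => xI; rewrite mulF_bernstein_weight.
by rewrite integral_poisson_semicircle.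
Qed.

Lemma bernstein_moment_chebU (n : nat) :
  bernstein_moment (F * G * chebU R n) = if n is 0 then pi / 2 else 0.
Proof.
rewrite /bernstein_moment /Rintegral.
have -> : (\int[mu]_(x in I) ((F * G * chebU R n).[x] * bernstein_weight x)%:E =
    \int[mu]_(x in I) (Num.sqrt (1 - x ^+ 2) * (chebU R n).[x])%:E)%E.
  apply: eq_integral => x; rewrite inE => xI.
  by rewrite hornerM mulrAC mulFG_bernstein_weight.
by rewrite integral_chebU_semicircle.
Qed.

End bernstein_szego.

(** * The measure [nu] as a normalized Bernstein-Szego weight *)

Section jacobi_moments.
Context {R : realType} (lambda theta : R).
Hypotheses (hl : 0 < lambda <= 1) (ht : 0 < theta <= (lambda + 1)^-1).
Local Notation mu := (@lebesgue_measure R).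
Local Notation I := (`[(-1)%R, 1%R]%classic : set R).
Local Notation nu := (jacobi_measure hl ht).
Local Notation b := (jacobi_b lambda theta).
Local Notation c := (jacobi_c lambda theta).
Local Notation Q := (jacobi_Q lambda theta).

(* With p = (1 - theta) r and q = theta r, the factors s + d x and 2 - s - d x of
   the denominator of the density are proportional to 1 + p^2 + 2 p x and
   1 + q^2 - 2 q x. *)
Let r : R := Num.sqrt (lambda / ((1 - theta) * (1 - lambda * theta))).
Let p : R := (1 - theta) * r.
Let q : R := theta * r.

Let bounds :
  [/\ 0 < lambda, lambda <= 1, 0 < theta & theta * (lambda + 1) <= 1].
Proof.
case/andP: hl => l0 l1; case/andP: ht => t0.
by rewrite -div1r ler_pdivlMr; [split | lra].
Qed.

Let theta_lt1 : 0 < 1 - theta. Proof. by case: bounds => *; nra. Qed.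

Lemma lambda_theta_lt1 : 0 < 1 - lambda * theta.
Proof. by case: bounds => *; nra. Qed.

Let mlt_gt0 := lambda_theta_lt1.

Let r2 : r ^+ 2 = lambda / ((1 - theta) * (1 - lambda * theta)).
Proof.
case: bounds => l0 *; rewrite sqr_sqrtr // divr_ge0 ?(ltW l0) //.
by rewrite mulr_ge0 // ltW.
Qed.

Let r_gt0 : 0 < r.
Proof. by case: bounds => l0 *; rewrite sqrtr_gt0 divr_gt0 // mulr_gt0. Qed.

(** After squaring, [p <= 1] becomes [lambda (1 - theta) <= 1 - lambda theta], that is,
    [lambda <= 1]. *)
Let p01 : 0 < p <= 1.
Proof.
case: bounds => l0 l1 t0 t1; rewrite mulr_gt0 //=.
rewrite -(@ler_pXn2r _ 2) ?nnegrE //; last first.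
  by rewrite ltW ?mulr_gt0.
rewrite expr1n exprMn r2 mulrA ler_pdivrMr ?mulr_gt0 // mul1r.
rewrite expr2 -mulrA ler_pM2l //.
by nra.
Qed.

(** After squaring, [q <= 1] becomes [lambda theta^2 <= (1 - theta) (1 - lambda theta)], that is,
    [theta (lambda + 1) <= 1]. *)
Let q01 : 0 < q <= 1.
Proof.
case: bounds => l0 l1 t0 t1; rewrite mulr_gt0 //=.
rewrite -(@ler_pXn2r _ 2) ?nnegrE //; last first.
  by rewrite ltW ?mulr_gt0.
rewrite expr1n exprMn r2 mulrA ler_pdivrMr ?mulr_gt0 // mul1r.
by nra.
Qed.

Let pqE : p * q = lambda * theta / (1 - lambda * theta).
Proof.
rewrite /p /q mulrACA -expr2 r2; field.
by rewrite !gt_eqF.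
Qed.

Let hb : 2 * b = q - p.
Proof. by rewrite /jacobi_b -/r /p /q; field. Qed.

Let hc : 1 - 2 * c = - (p * q).
Proof. by rewrite /jacobi_c pqE; field; rewrite gt_eqF. Qed.

(** The inverse of the mass [pi / 2 / (1 + p q)] of the Bernstein-Szego weight. *)
Let kappa : R := 2 * (1 + p * q) / pi.

Lemma jacobi_densityE x :
  jacobi_density lambda theta x = kappa * bernstein_weight p q x * \1_I x.
Proof.
rewrite /jacobi_density; congr (_ * _).
case: bounds => l0 l1 t0 t1.
have dE : jacobi_d lambda theta =
    4 * theta * (1 - theta) * (1 - lambda * theta) * r.
  rewrite /jacobi_d (_ : lambda * (1 - theta) * (1 - lambda * theta) =
    (lambda / ((1 - theta) * (1 - lambda * theta))) *
    ((1 - theta) * (1 - lambda * theta)) ^+ 2).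
    rewrite sqrtrM ?sqrtr_sqr; last by rewrite -r2 sqr_ge0.
    by rewrite -/r ger0_norm ?mulr_ge0 ?ltW //; ring.
  by field; rewrite !gt_eqF.
have DE : jacobi_s lambda theta * (2 - jacobi_s lambda theta)
    + 2 * jacobi_d lambda theta * (1 - jacobi_s lambda theta) * x
    - jacobi_d lambda theta ^+ 2 * x ^+ 2 =
    4 * theta * (1 - theta) * (1 - lambda * theta) ^+ 2 *
    ((1 + p ^+ 2 + 2 * p * x) * (1 + q ^+ 2 - 2 * q * x)).
  have sE : jacobi_s lambda theta =
      2 * theta * (1 - lambda * theta) * (1 + p ^+ 2).
    by rewrite /jacobi_s exprMn r2; field; rewrite !gt_eqF.
  have s2E : 2 - jacobi_s lambda theta =
      2 * (1 - theta) * (1 - lambda * theta) * (1 + q ^+ 2).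
    by rewrite /jacobi_s exprMn r2; field; rewrite !gt_eqF.
  transitivity ((jacobi_s lambda theta + jacobi_d lambda theta * x) *
    (2 - jacobi_s lambda theta - jacobi_d lambda theta * x)); first by ring.
  by rewrite s2E sE dE /p /q; ring.
rewrite DE [(_ * (_ * _))^-1]invfM /bernstein_weight.
(* Here [x] is an arbitrary real, so the factors may vanish; their inverse is abstracted, and only
   constants remain to be compared. *)
move: (_ * (1 + q ^+ 2 - _))^-1 (Num.sqrt _) => u v.
rewrite jacobi_d2 // /kappa pqE; move: (pi) (pi_gt0 R) => P P0.
by field; rewrite !gt_eqF.
Qed.

Lemma mul_jacobi_densityE (f : {poly R}) :
  (fun x => f.[x] * jacobi_density lambda theta x) =
  (fun x => kappa * (f.[x] * bernstein_weight p q x)) \_ I.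
Proof.
apply/funext => x; rewrite jacobi_densityE patchE indicE; case: ifPn => _.
  by rewrite mulr1; ring.
by rewrite !mulr0.
Qed.

Lemma integrable_jacobi_horner (f : {poly R}) :
  nu.-integrable setT (fun x => f.[x]%:E).
Proof.
apply: (@integrable_density _ _ _ mu nu (jacobi_density lambda theta)) => //.
- by move=> x; exact: jacobi_density_ge0.
- exact: measurable_jacobi_density.
- exact: measurable_poly.
- rewrite (_ : (fun _ => _) = EFin \o
    (fun x => kappa * (f.[x] * bernstein_weight p q x)) \_ I); last first.
    by apply/funext => x; rewrite /= -mul_jacobi_densityE.
  rewrite -restrict_EFin.
  apply: (integrable_mkcond (EFin \o _) _).1; first exact: measurable_itv.
  have h := integrable_mul_bernstein_weight p01 q01 f.
  by apply: (integrableZl _ kappa h); exact: measurable_itv.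
Qed.

Lemma jacobi_integralE (f : {poly R}) :
  \int[nu]_x f.[x] = kappa * bernstein_moment p q f.
Proof.
rewrite (@Rintegral_density _ _ _ mu nu (jacobi_density lambda theta)) //.
- rewrite mul_jacobi_densityE -Rintegral_mkcond RintegralZl //.
  exact: integrable_mul_bernstein_weight.
- by move=> x; exact: jacobi_density_ge0.
- exact: measurable_jacobi_density.
- exact: measurable_poly.
Qed.

Definition jacobi_functional (f : {poly R}) : R := \int[nu]_x f.[x].

Lemma jacobi_functional_scalar : scalar jacobi_functional.
Proof.
move=> a f g; rewrite /jacobi_functional !jacobi_integralE.
by rewrite (bernstein_moment_scalar p01 q01 a f g); ring.
Qed.

Let LD := functionalD jacobi_functional_scalar.
Let LZ := functionalZ jacobi_functional_scalar.

Lemma jacobi_functional1 : jacobi_functional 1 = 1.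
Proof.
rewrite /jacobi_functional jacobi_integralE bernstein_moment1 // /kappa.
have : 0 < 1 + p * q.
  case/andP: p01 => p0 _; case/andP: q01 => q0 _.
  by have := mulr_gt0 p0 q0; lra.
by move: (pi) (pi_gt0 R) => P P0 ?; field; rewrite !gt_eqF.
Qed.

Lemma jacobi_functional_chebU (n : nat) : jacobi_functional
   (((1 + p ^+ 2)%:P + (2 * p) *: 'X) * ((1 + q ^+ 2)%:P - (2 * q) *: 'X)
    * chebU R n) = if n is 0 then 1 + p * q else 0.
Proof.
rewrite /jacobi_functional jacobi_integralE bernstein_moment_chebU // /kappa.
case: n => [|n]; last by rewrite mulr0.
by move: (pi) (pi_gt0 R) => P P0; field; rewrite gt_eqF.
Qed.

Lemma jacobi_functional_QS n : jacobi_functional (Q n.+1) = 0.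
Proof.
have [p0 q0] : p != 0 /\ q != 0.
  by case/andP: p01 => p0 _; case/andP: q01 => q0 _; rewrite !gt_eqF.
have LC (a : R) : jacobi_functional a%:P = a.
  by rewrite -[a%:P]mulr1 mul_polyC LZ jacobi_functional1 mulr1.
have LB u v w (a a' : R) : jacobi_functional (u - a *: v - a' *: w) =
    jacobi_functional u - a * jacobi_functional v - a' * jacobi_functional w.
  by rewrite -(scaleNr a v) -(scaleNr a' w) !LD !LZ !mulNr.
have LQ1 : jacobi_functional (Q 1%N) = 0.
  (* The integral [1 + p q] of the factor [1 + p^2 + 2 p x] determines the mean
     [(q - p) / 2 = b]. *)
  have LF : jacobi_functional ((1 + p ^+ 2)%:P + (2 * p) *: 'X) = 1 + p * q.
    rewrite /jacobi_functional jacobi_integralE //.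
    rewrite bernstein_moment_linear_factor //.
    by rewrite /kappa; move: (pi) (pi_gt0 R) => P P0; field; rewrite gt_eqF.
  have LX : jacobi_functional 'X * (2 * p) = p * q - p ^+ 2.
    by move: LF; rewrite LD LZ LC => h; lra.
  rewrite jacobi_Q1 hb -polyCN LD LC.
  have -> : jacobi_functional (2%:P * 'X) = 2 * jacobi_functional 'X.
    by rewrite mul_polyC LZ.
  by apply: (mulfI p0); rewrite mulr0; lra.
(* For [k = 0] the exceptional constant [1 + p q] cancels against the integral of the semicircle
   term, which leaves 0 instead of [L(Q_0) = 1]. *)
have rec k : p * q * jacobi_functional (Q k.+2) =
    (if k is 0 then 0 else jacobi_functional (Q k)) -
    (q - p) * jacobi_functional (Q k.+1).
  have := jacobi_functional_chebU k.
  rewrite (jacobi_Q_bernstein _ hb hc) LB.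
  by case: k => [|k]; rewrite ?LC => h; lra.
suff: forall k,
    jacobi_functional (Q k.+1) = 0 /\ jacobi_functional (Q k.+2) = 0.
  by move=> /(_ n)[].
have pq0 : p * q != 0 by rewrite mulf_neq0.
elim=> [|k [IH1 IH2]]; split=> //; apply: (mulfI pq0); rewrite rec mulr0.
  by rewrite LQ1 mulr0 subr0.
by rewrite IH1 IH2 mulr0 subr0.
Qed.

End jacobi_moments.

(** * The vacuum distribution *)

Section fock_vacuum.
Context (R : realType) (alpha omega : nat -> R).
Local Notation H := (fock_hamiltonian omega alpha).

Lemma finite_support_Phi_span (m : nat) (f : nat -> R[i]) :
  (forall n, (m <= n)%N -> f n = 0) -> Phi_span f.
Proof.
move=> f0; exists m, f; apply/funext => n; rewrite /Phi.
have [nm|mn] := ltnP n m; last first.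
  rewrite f0 // big1 // => k _; rewrite gtn_eqF ?mulr0 //.
  exact: leq_trans (ltn_ord k) mn.
rewrite (bigD1 (Ordinal nm)) //= eqxx mulr1 big1 ?addr0 // => k kn.
rewrite (_ : (n == k) = false) ?mulr0 //.
by apply: contraNF kn => /eqP nk; apply/eqP/val_inj.
Qed.

Lemma iter_hamiltonian_support k n : (k < n)%N -> iter k H (Phi R 0) n = 0.
Proof.
elim: k n => [|k IH] [|n] //= kn.
rewrite /fock_hamiltonian /creation /annihilation /number_calculus.
by rewrite !IH ?mulr0 ?addr0 // ltnW // ltnW.
Qed.

(** Each application of the Hamiltonian raises the support by at most one, so all iterates of the
    vacuum stay in the span of the [Phi_n], where [X] is prescribed. *)
Lemma iter_extension D X k : extends D X (@Phi_span R) H ->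
  iter k X (Phi R 0) = iter k H (Phi R 0).
Proof.
move=> [_ XH]; elim: k => [|k IH] //=; rewrite IH XH //; apply: mem_set.
by apply: (@finite_support_Phi_span k.+1) => n; exact: iter_hamiltonian_support.
Qed.

Lemma fock_inner_vacuum (f : nat -> R[i]) :
  fock_inner omega (Phi R 0) f = f 0%N.
Proof.
have sepC : hausdorff_space (R[i]^o) by exact: norm_hausdorff.
apply: (@lim_near_cst _ sepC nat \oo _ (f 0%N)).
(* The partial sums are constant from index 1 on: the one at index 0 is empty, and only the term of
   index 0, of weight 1, is nonzero. *)
exists 1%N => // -[|n] //= _; rewrite /series /= big_nat_recl //=.
rewrite big1 => [|k _].
  rewrite addr0 /fock_weight big_geq //= oppr0.
  by rewrite -[(1 +i* 0)%C]/(1 : R[i]) !mul1r.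
by rewrite oppr0 -[(0 +i* 0)%C]/(0 : R[i]) mulr0 mul0r.
Qed.

Lemma fock_weightS n :
  fock_weight omega n.+1 = fock_weight omega n * omega n.+1.
Proof. by rewrite /fock_weight big_nat_recr. Qed.

Context (L : {poly R} -> R) (P : nat -> {poly R}).
Hypothesis L_scalar : scalar L.
Hypothesis recP : forall n, ('X - (alpha n)%:P) * P n =
  P n.+1 + omega n *: (if n is m.+1 then P m else 0).
Hypothesis P0 : P 0 = 1.
Hypothesis L1 : L 1 = 1.
Hypothesis LPS : forall n, L (P n.+1) = 0.

(** Both sides obey the same recurrence in [k]: since [fock_weight n.+1 = fock_weight n * omega
    n.+1], the weights convert creation into the term in [P_{n-1}] and annihilation into the term in
    [P_{n+1}] of ['X * P n]. *)
Lemma functional_hamiltonian k n :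
  (L ('X^k * P n))%:C%C = (fock_weight omega n)%:C%C * iter k H (Phi R 0) n.
Proof.
elim: k n => [|k IH] n.
  rewrite expr0 mul1r /=; case: n => [|n]; last by rewrite LPS mulr0.
  by rewrite P0 L1 /fock_weight big_geq // mul1r.
have L0 : L 0 = 0 by rewrite -(scale0r 0) (functionalZ L_scalar) mul0r.
rewrite iterS; move: (iter k H _) IH => v IH.
rewrite exprSr -mulrA (mulX_three_term recP) !(mulrDr 'X^k) -!scalerAr.
rewrite !(functionalD L_scalar) !(functionalZ L_scalar).
rewrite /fock_hamiltonian /creation /annihilation /number_calculus.
rewrite !(rmorphD, rmorphM) /= !IH fock_weightS rmorphM /=.
case: n => [|n]; first by rewrite mulr0 L0; ring.
by rewrite IH fock_weightS rmorphM /=; ring.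
Qed.

End fock_vacuum.

(** * Orthogonality, Jacobi-Szego parameters and vacuum moments of [nu] *)

Section main.
Context (R : realType) (lambda theta : R).
Context (hl : 0 < lambda <= 1) (ht : 0 < theta <= (lambda + 1)^-1).
Local Notation nu := (jacobi_measure hl ht).
Local Notation alpha := (jacobi_alpha lambda theta).
Local Notation omega := (jacobi_omega lambda theta).
Local Notation P := (jacobi_monic lambda theta).
Local Notation L := (jacobi_functional hl ht).

Lemma jacobi_monic0 : P 0 = 1.
Proof. by rewrite /jacobi_monic expr0 scale1r jacobi_Q0. Qed.

Let P0 := jacobi_monic0.
Let recP := jacobi_monic_recurrence lambda theta.
Let Lscalar := jacobi_functional_scalar hl ht.

Lemma jacobi_functional_monicS n : L (P n.+1) = 0.
Proof.
rewrite /jacobi_monic (functionalZ Lscalar).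
by rewrite jacobi_functional_QS mulr0.
Qed.

Lemma jacobi_omega_gt0 n : 0 < omega n.
Proof.
rewrite /jacobi_omega; case: ifP => _; last by rewrite invr_gt0.
by rewrite divr_gt0 // /jacobi_c invr_gt0 mulr_gt0 // lambda_theta_lt1.
Qed.

Lemma jacobi_finite_moments : finite_moments nu.
Proof.
move=> k; have := integrable_jacobi_horner hl ht 'X^k.
by under eq_fun do rewrite hornerXn.
Qed.

(** One argument for two families: [a n = 2 ^+ n] gives the [Q_n], and [a n = 1] the monic
    polynomials. *)
Lemma orthogonal_scaled_jacobi_monic (a : nat -> R) : (forall n, a n != 0) ->
  orthogonal_polynomials nu (fun n => a n *: P n).
Proof.
move=> a0.
have Lmul (m n : nat) : \int[nu]_x ((a m *: P m).[x] * (a n *: P n).[x]) =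
    a m * a n * L (P m * P n).
  rewrite -(functionalZ Lscalar) /jacobi_functional.
  by apply: eq_Rintegral => x _; rewrite !(hornerZ, hornerM); ring.
split.
- exact: jacobi_finite_moments.
- move=> n; rewrite size_scale //.
  exact: (three_term_monic_size recP P0 n).2.
- move=> n; under eq_Rintegral do rewrite expr2.
  rewrite Lmul (functional_square Lscalar recP P0 (jacobi_functional1 hl ht)
    jacobi_functional_monicS).
  rewrite mulr_gt0 // ?prodr_gt0 //.
    by rewrite -expr2 exprn_even_gt0 ?a0 ?orbT.
  by move=> k _; exact: jacobi_omega_gt0.
- move=> m n mn; rewrite Lmul.
  rewrite (functional_orthogonal Lscalar recP P0 jacobi_functional_monicS) //.
  by rewrite mulr0.
Qed.
End main.

Theorem mainTheorem6 (R : realType) (lambda theta : R)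
    (hl : 0 < lambda <= 1) (ht : 0 < theta <= (lambda + 1)^-1) :
  let nu := jacobi_measure hl ht in
  let alpha := jacobi_alpha lambda theta in
  let omega := jacobi_omega lambda theta in
  [/\ orthogonal_polynomials nu (jacobi_Q lambda theta),
      jacobi_szego nu alpha omega,
      forall n : nat, (1 <= n)%N -> 0 < omega n &
      forall (D : set (nat -> R[i])) (X : (nat -> R[i]) -> (nat -> R[i])),
        fock_operator omega D X ->
        extends D X (@Phi_span R) (fock_hamiltonian omega alpha) ->
        vacuum_distribution omega X nu].
Proof.
move=> nu alpha omega; split.
- rewrite (_ : jacobi_Q lambda theta =
    fun n => 2 ^+ n *: jacobi_monic lambda theta n).
    by apply: orthogonal_scaled_jacobi_monic => n; rewrite expf_neq0 ?pnatr_eq0.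
  apply/funext => n.
  by rewrite scalerA -exprMn divff ?pnatr_eq0 // expr1n scale1r.
- exists (jacobi_monic lambda theta); split.
  + rewrite (_ : jacobi_monic lambda theta =
      fun n => 1 *: jacobi_monic lambda theta n).
      by apply: orthogonal_scaled_jacobi_monic => n; exact: oner_neq0.
    by apply/funext => n; rewrite scale1r.
  + move=> n.
    exact: (three_term_monic_size
      (jacobi_monic_recurrence lambda theta) (jacobi_monic0 _ _) n).1.
  + exact: jacobi_monic_recurrence.
- by move=> n _; exact: jacobi_omega_gt0.
- move=> D X _ XH; split; first exact: jacobi_finite_moments.
  move=> k; rewrite (iter_extension k XH) fock_inner_vacuum.
  (* At [n = 0] the weight and [P_0] are both 1, so the vacuum coordinate is the [k]-th moment. *)
  have := functional_hamiltonian (jacobi_functional_scalar hl ht)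
    (jacobi_monic_recurrence lambda theta) (jacobi_monic0 _ _)
    (jacobi_functional1 hl ht) (jacobi_functional_monicS hl ht) k 0.
  rewrite /fock_weight big_geq // mul1r => <-; congr (_%:C%C).
  rewrite jacobi_monic0 mulr1; apply: eq_Rintegral => x _.
  by rewrite hornerXn.
Qed.
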